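(* A truss $T$ is rectangular if and only if $T\cong L\times R$ (as trusses) for some left zero truss $L$ and right zero truss $R$. Moreover, if $T$ is rectangular, then the ring $\mathrm{R}(T)$ is a zero multiplication ring; that is, for every $e\in T$ the ring $\mathrm{R}(T,e)$ has zero multiplication.
   Context: An Abelian heap is a set $H$ with a ternary operation $[-,-,-]$ such that for all $a_1,\dots,a_5\in H$: $[[a_1,a_2,a_3],a_4,a_5]=[a_1,a_2,[a_3,a_4,a_5]]$; $[a_1,a_2,a_2]=a_1$ and $[a_2,a_1,a_1]=a_2$; $[a_1,a_2,a_3]=[a_3,a_2,a_1]$. A truss is an Abelian heap $(T,[-,-,-])$ with an associative binary operation $\cdot$ satisfying $a\cdot[b,c,d]=[a\cdot b,a\cdot c,a\cdot d]$ and $[b,c,d]\cdot a=[b\cdot a,c\cdot a,d\cdot a]$ for all $a,b,c,d\in T$. A truss isomorphism is a bijection preserving both operations; direct products carry componentwise operations. A truss $T$ is rectangular if $aba=a$ for all $a,b\in T$. A left zero truss is an Abelian heap with multiplication $a\cdot b=a$ for all $a,b$; a right zero truss is an Abelian heap with multiplication $a\cdot b=b$ for all $a,b$. For a truss $T$ and $e\in T$, $\mathrm{R}(T,e)$ denotes the ring $(T,+_e,\bullet_e)$ with zero element $e$, where $a+_e b=[a,e,b]$ and $a\bullet_e b=[[a\cdot b,a\cdot e,e],e\cdot b,e^2]$; it is known that this is an (associative, not necessarily unital) ring and that its isomorphism class does not depend on $e$, so one writes $\mathrm{R}(T)$ for it. A zero multiplication ring is a ring in which every product equals zero. *)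

(* Defs.v *)
From HB Require Import structures.
From mathcomp Require Import ssreflect ssrfun ssrbool.

Set Implicit Arguments.
Unset Strict Implicit.
Unset Printing Implicit Defensive.

Declare Scope truss_scope.
Delimit Scope truss_scope with truss.
Local Open Scope truss_scope.

(* The carrier of a heap may be empty, and no decidable equality is assumed. *)
HB.mixin Record isAbelianHeap (T : Type) := {
  heap : T -> T -> T -> T;
  heapA : forall a b c d f,
    heap (heap a b c) d f = heap a b (heap c d f);
  heapK : forall a b, heap a b b = a;
  heapC : forall a b c, heap a b c = heap c b a
}.

#[short(type="abelianHeapType")]
HB.structure Definition AbelianHeap := {T of isAbelianHeap T}.

Notation "[ 'heap' a , b , c ]" := (heap a b c)
  (at level 0, a, b, c at level 99, format "[ 'heap'  a ,  b ,  c ]") :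
  truss_scope.

HB.mixin Record AbelianHeap_isTruss T of AbelianHeap T := {
  tmul : T -> T -> T;
  tmulA : associative tmul;
  tmulHr : forall a b c d : T,
    tmul a [heap b, c, d] = [heap tmul a b, tmul a c, tmul a d];
  tmulHl : forall a b c d : T,
    tmul [heap b, c, d] a = [heap tmul b a, tmul c a, tmul d a]
}.

#[short(type="trussType")]
HB.structure Definition Truss :=
  {T of AbelianHeap T & AbelianHeap_isTruss T}.

Notation "a * b" := (tmul a b) : truss_scope.

Definition prod_heap (H K : abelianHeapType) (a b c : H * K) : H * K :=
  ([heap a.1, b.1, c.1], [heap a.2, b.2, c.2]).

Lemma prod_heapA (H K : abelianHeapType) (a b c d f : H * K) :
  prod_heap (prod_heap a b c) d f = prod_heap a b (prod_heap c d f).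
Proof. by rewrite /prod_heap /= !heapA. Qed.

Lemma prod_heapK (H K : abelianHeapType) (a b : H * K) :
  prod_heap a b b = a.
Proof. by case: a => a1 a2; rewrite /prod_heap /= !heapK. Qed.

Lemma prod_heapC (H K : abelianHeapType) (a b c : H * K) :
  prod_heap a b c = prod_heap c b a.
Proof. by congr pair; apply: heapC. Qed.

HB.instance Definition _ (H K : abelianHeapType) :=
  isAbelianHeap.Build (H * K)%type
    (@prod_heapA H K) (@prod_heapK H K) (@prod_heapC H K).

Definition prod_tmul (S T : trussType) (a b : S * T) : S * T :=
  (a.1 * b.1, a.2 * b.2).

Lemma prod_tmulA (S T : trussType) : associative (@prod_tmul S T).
Proof. by move=> a b c; rewrite /prod_tmul /= !tmulA. Qed.

Lemma prod_tmulHr (S T : trussType) (a b c d : S * T) :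
  prod_tmul a [heap b, c, d] =
  [heap prod_tmul a b, prod_tmul a c, prod_tmul a d].
Proof. by congr pair; apply: tmulHr. Qed.

Lemma prod_tmulHl (S T : trussType) (a b c d : S * T) :
  prod_tmul [heap b, c, d] a =
  [heap prod_tmul b a, prod_tmul c a, prod_tmul d a].
Proof. by congr pair; apply: tmulHl. Qed.

HB.instance Definition _ (S T : trussType) :=
  AbelianHeap_isTruss.Build (S * T)%type
    (@prod_tmulA S T) (@prod_tmulHr S T) (@prod_tmulHl S T).

Definition truss_isomorphic (S T : trussType) : Prop :=
  exists f : S -> T,
    [/\ bijective f,
        forall a b c : S, f [heap a, b, c] = [heap f a, f b, f c]
      & forall a b : S, f (a * b) = f a * f b].

Definition rectangular (T : trussType) : Prop :=
  forall a b : T, a * b * a = a.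

Definition left_zero_truss (T : trussType) : Prop :=
  forall a b : T, a * b = a.

Definition right_zero_truss (T : trussType) : Prop :=
  forall a b : T, a * b = b.

(* Associative, not necessarily unital rings; the rings of the algebra library are
   unital and have a carrier with a choice operator. *)
HB.mixin Record isRng (A : Type) := {
  rzero : A;
  radd : A -> A -> A;
  ropp : A -> A;
  rmul : A -> A -> A;
  raddA : associative radd;
  raddC : commutative radd;
  radd0 : left_id rzero radd;
  raddN : left_inverse rzero ropp radd;
  rmulA : associative rmul;
  rmulDl : left_distributive rmul radd;
  rmulDr : right_distributive rmul radd
}.

#[short(type="rngType")]
HB.structure Definition Rng := {A of isRng A}.

Definition zero_multiplication (A : rngType) : Prop :=
  forall x y : A, rmul x y = rzero.

Lemma heapKl (H : abelianHeapType) (a b : H) : [heap b, b, a] = a.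
Proof. by rewrite heapC heapK. Qed.

Lemma heapACr (H : abelianHeapType) (x b c d f : H) :
  [heap [heap x, b, c], d, f] = [heap [heap x, b, f], d, c].
Proof. by rewrite !heapA (heapC c). Qed.

Lemma heapAm (H : abelianHeapType) (a b c d f : H) :
  [heap a, [heap b, c, d], f] = [heap [heap a, d, c], b, f].
Proof.
set u := [heap b, c, d].
rewrite -[in RHS](heapKl f u) -[RHS]heapA; congr heap.
by rewrite /u -heapA heapK heapA heapKl heapK.
Qed.

Lemma heapACl (H : abelianHeapType) (x b c d f : H) :
  [heap [heap x, b, c], d, f] = [heap [heap x, d, c], b, f].
Proof. by rewrite -!heapAm (heapC b). Qed.

Lemma heapCan (H : abelianHeapType) (x b c d : H) :
  [heap [heap x, b, c], c, d] = [heap x, b, d].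
Proof. by rewrite heapA heapKl. Qed.

(* The parameter [e] is kept in the type so that each [e] has its own ring
   structure. *)
Definition truss_ring (T : trussType) (e : T) : Type := T.

Definition truss_radd (T : trussType) (e a b : T) : T := [heap a, e, b].

Definition truss_ropp (T : trussType) (e a : T) : T := [heap e, a, e].

Definition truss_rmul (T : trussType) (e a b : T) : T :=
  [heap [heap a * b, a * e, e], e * b, e * e].

Lemma truss_raddA (T : trussType) (e : T) : associative (truss_radd e).
Proof. by move=> a b c; rewrite /truss_radd heapA. Qed.

Lemma truss_raddC (T : trussType) (e : T) : commutative (truss_radd e).
Proof. by move=> a b; apply: heapC. Qed.

Lemma truss_radd0 (T : trussType) (e : T) : left_id e (truss_radd e).
Proof. by move=> a; apply: heapKl. Qed.

Lemma truss_raddN (T : trussType) (e : T) :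
  left_inverse e (truss_ropp e) (truss_radd e).
Proof.
by move=> a; rewrite /truss_radd /truss_ropp heapA heapKl heapK.
Qed.

Lemma truss_rmulA (T : trussType) (e : T) : associative (truss_rmul e).
Proof.
move=> a b c; rewrite /truss_rmul !(tmulHr, tmulHl) ?(heapAm, =^~ heapA) ?tmulA.
rewrite (heapACl _ (a * e * c) _ (a * e)) heapCan.
rewrite [in RHS](heapACl _ (a * b * e) _ (e * c))
  [in RHS](heapACl _ (e * e) _ (e * c))
  [in RHS](heapACl _ (e * e * e) _ (e * c))
  [in RHS](heapACl _ (e * b * c) _ (e * c))
  heapCan.
rewrite [in RHS](heapACl _ (e * e) _ (a * b * e))
  [in RHS](heapACl _ (e * e * e) _ (a * b * e))
  [in RHS](heapACl _ (e * b * c) _ (a * b * e))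
  [in RHS](heapACl _ (a * e * c) _ (a * b * e))
  [in RHS](heapACl _ (e * b * c) _ (e * e * e))
  [in RHS](heapACl _ (e * b * c) _ (e * e)).
by rewrite [in RHS](heapACr _ _ (e * b * e) _ (a * e * e))
  [in RHS](heapACr _ _ (e * e * c) _ (a * e * e))
  [in RHS](heapACr _ _ (e * b * e) _ (e))
  [in RHS](heapACr _ _ (e * e * c) _ (e)).
Qed.

Lemma truss_rmulDl (T : trussType) (e : T) :
  left_distributive (truss_rmul e) (truss_radd e).
Proof.
move=> a b c; rewrite /truss_rmul /truss_radd !(tmulHr, tmulHl) ?(heapAm, =^~ heapA) ?tmulA.
congr heap.
rewrite [in RHS](heapACl _ (e * c) _ e) heapCan.
rewrite (heapACl _ (b * e) _ (a * e)) (heapACl _ (e * c) _ (a * e)).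
by rewrite (heapACr _ _ (b * c) _ (e * e)).
Qed.

Lemma truss_rmulDr (T : trussType) (e : T) :
  right_distributive (truss_rmul e) (truss_radd e).
Proof.
move=> a b c; rewrite /truss_rmul /truss_radd !(tmulHr, tmulHl) ?(heapAm, =^~ heapA) ?tmulA.
rewrite [in RHS](heapACl _ (e * b) _ e) heapCan.
rewrite [in LHS](heapACl _ (e * c) _ (e * b)).
rewrite [in LHS](heapACl _ (a * e) _ (e * b)).
rewrite [in RHS](heapACr _ _ (e * e) _ (a * c)).
by rewrite [in RHS](heapACr _ _ (e * e) _ e).
Qed.

HB.instance Definition _ (T : trussType) (e : T) :=
  isRng.Build (truss_ring e)
    (@truss_raddA T e) (@truss_raddC T e) (@truss_radd0 T e)
    (@truss_raddN T e) (@truss_rmulA T e)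
    (@truss_rmulDl T e) (@truss_rmulDr T e).

(* Main.v *)
Require Import Defs.
From Stdlib Require Import Classical.
From HB Require Import structures.
From mathcomp Require Import ssreflect ssrfun ssrbool.

Set Implicit Arguments.
Unset Strict Implicit.
Unset Printing Implicit Defensive.

Local Open Scope truss_scope.

(** The multiplicative semigroup of a rectangular truss is a rectangular band:
    [a * a = a] and [a * b * c = a * c]. Fix [e] in [T]. The fixed points of
    right multiplication by [e] form a subtruss [T * e] in which products
    collapse to their left factor; dually, [e * T] is a right zero truss. The
    map [a |-> (a * e, e * a)] is an isomorphism with inverse
    [(x, y) |-> x * y]. It respects the heap operation by distributivity and
    the product because a rectangular band drops middle factors. An empty truss has no [e] to start from, but it is left
    zero, right zero and isomorphic to its own square.

    For the ring, expanding [x := truss_rmul e a b] by distributivity shows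
    that [e * x] and [x * e] are both [e]: cancelling the inner factors leaves
    heap words whose entries cancel in pairs. Rectangularity then gives
    [x = x * e * x = e * x = e], which is the zero of the ring. *)

(** * Rectangular bands *)

Lemma rectangular_idem (T : trussType) (rectT : rectangular T) (a : T) :
  a * a = a.
Proof.
(* Both sides are bracketings of the fourth power of [a]. *)
by rewrite -{1}(rectT a a) -(tmulA a a a) rectT.
Qed.

(** Insert [a] into [c = c * a * c]: then [a * (b * c) * a] collapses to [a]. *)
Lemma rectangular_mid (T : trussType) (rectT : rectangular T) (a b c : T) :
  a * b * c = a * c.
Proof. by rewrite -{1}(rectT c a) !tmulA -(tmulA a b c) rectT. Qed.

(** An identity between products pulls back along an injective multiplicative
    map, and in [L * R] each coordinate of [a * b * a] keeps the outer factor. *)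
Lemma rectangular_of_iso_prod (T L R : trussType) :
  left_zero_truss L -> right_zero_truss R ->
  truss_isomorphic T (L * R)%type -> rectangular T.
Proof.
move=> zL zR [f [f_bij _ fM]] a b; apply: (bij_inj f_bij); rewrite !fM.
case: (f a) (f b) => [a1 a2] [b1 b2].
have e1 : a1 * b1 * a1 = a1 by rewrite !zL.
have e2 : a2 * b2 * a2 = a2 by rewrite !zR.
exact: (f_equal2 pair e1 e2).
Qed.

(** * Subtrusses *)

Definition heap_closed (T : trussType) (P : T -> Prop) : Prop :=
  forall a b c, P a -> P b -> P c -> P [heap a, b, c].

Definition tmul_closed (T : trussType) (P : T -> Prop) : Prop :=
  forall a b, P a -> P b -> P (a * b).

(** The closure proofs are parameters of the type so that the structures below
    can be inferred from it. *)
Definition subtruss (T : trussType) (P : T -> Prop)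
  (PH : heap_closed P) (PM : tmul_closed P) : Type := {x : T | P x}.

Definition subtruss_val (T : trussType) (P : T -> Prop)
  (PH : heap_closed P) (PM : tmul_closed P) (x : subtruss PH PM) : T :=
  proj1_sig x.

Section Subtruss.

Variables (T : trussType) (P : T -> Prop).
Variables (PH : heap_closed P) (PM : tmul_closed P).

Local Notation S := (subtruss PH PM).

Lemma subtruss_val_inj : injective (@subtruss_val T P PH PM).
Proof.
by move=> [x Px] [y Py] /= exy; subst y; rewrite (proof_irrelevance _ Px Py).
Qed.

Definition subtruss_heap (a b c : S) : S :=
  exist _ _ (PH (proj2_sig a) (proj2_sig b) (proj2_sig c)).

Definition subtruss_tmul (a b : S) : S :=
  exist _ _ (PM (proj2_sig a) (proj2_sig b)).

Lemma subtruss_heapA (a b c d f : S) :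
  subtruss_heap (subtruss_heap a b c) d f =
  subtruss_heap a b (subtruss_heap c d f).
Proof. exact/subtruss_val_inj/heapA. Qed.

Lemma subtruss_heapK (a b : S) : subtruss_heap a b b = a.
Proof. exact/subtruss_val_inj/heapK. Qed.

Lemma subtruss_heapC (a b c : S) : subtruss_heap a b c = subtruss_heap c b a.
Proof. exact/subtruss_val_inj/heapC. Qed.

HB.instance Definition _ :=
  isAbelianHeap.Build S subtruss_heapA subtruss_heapK subtruss_heapC.

Lemma subtruss_tmulA : associative subtruss_tmul.
Proof. by move=> a b c; exact/subtruss_val_inj/tmulA. Qed.

Lemma subtruss_tmulHr (a b c d : S) :
  subtruss_tmul a [heap b, c, d] =
  [heap subtruss_tmul a b, subtruss_tmul a c, subtruss_tmul a d].
Proof. exact/subtruss_val_inj/tmulHr. Qed.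

Lemma subtruss_tmulHl (a b c d : S) :
  subtruss_tmul [heap b, c, d] a =
  [heap subtruss_tmul b a, subtruss_tmul c a, subtruss_tmul d a].
Proof. exact/subtruss_val_inj/tmulHl. Qed.

HB.instance Definition _ :=
  AbelianHeap_isTruss.Build S subtruss_tmulA subtruss_tmulHr subtruss_tmulHl.

End Subtruss.

(** * The two factors *)

(** Describing [T * e] as the fixed points of right multiplication by [e]
    makes it a subtruss for every [e], and it is all of [T * e] as soon as [e]
    is idempotent. *)
Definition right_fixed (T : trussType) (e x : T) : Prop := x * e = x.

Definition left_fixed (T : trussType) (e x : T) : Prop := e * x = x.

Lemma right_fixed_heap (T : trussType) (e : T) : heap_closed (right_fixed e).
Proof.
by move=> a b c ha hb hc; rewrite /right_fixed tmulHl ha hb hc.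
Qed.

Lemma right_fixed_tmul (T : trussType) (e : T) : tmul_closed (right_fixed e).
Proof. by move=> a b _ hb; rewrite /right_fixed -tmulA hb. Qed.

Lemma left_fixed_heap (T : trussType) (e : T) : heap_closed (left_fixed e).
Proof.
by move=> a b c ha hb hc; rewrite /left_fixed tmulHr ha hb hc.
Qed.

Lemma left_fixed_tmul (T : trussType) (e : T) : tmul_closed (left_fixed e).
Proof. by move=> a b ha _; rewrite /left_fixed tmulA ha. Qed.

Definition left_factor (T : trussType) (e : T) : trussType :=
  subtruss (@right_fixed_heap T e) (@right_fixed_tmul T e).

Definition right_factor (T : trussType) (e : T) : trussType :=
  subtruss (@left_fixed_heap T e) (@left_fixed_tmul T e).

Lemma left_factor_zero (T : trussType) (rectT : rectangular T) (e : T) :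
  left_zero_truss (left_factor e).
Proof.
move=> [x hx] [y hy]; apply: subtruss_val_inj; rewrite /tmul /=.
by rewrite -hy tmulA rectangular_mid.
Qed.

Lemma right_factor_zero (T : trussType) (rectT : rectangular T) (e : T) :
  right_zero_truss (right_factor e).
Proof.
move=> [x hx] [y hy]; apply: subtruss_val_inj; rewrite /tmul /=.
by rewrite -hx rectangular_mid.
Qed.

(** Both coordinates of [a |-> (a * e, e * a)] are determined by, and together
    recover, [a]: the product [(a * e) * (e * a)] collapses to [a]. *)
Lemma rectangular_iso (T : trussType) (rectT : rectangular T) (e : T) :
  truss_isomorphic T (left_factor e * right_factor e)%type.
Proof.
have fixR a : right_fixed e (a * e) by rewrite /right_fixed rectangular_mid.
have fixL a : left_fixed e (e * a).
  by rewrite /left_fixed tmulA rectangular_mid.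
pose f (a : T) : left_factor e * right_factor e :=
  (exist _ _ (fixR a), exist _ _ (fixL a)).
pose g (p : left_factor e * right_factor e) : T :=
  subtruss_val p.1 * subtruss_val p.2.
exists f; split.
- exists g => [a | [[x hx] [y hy]]].
    by rewrite /g /= tmulA rectangular_mid // rectT.
  congr pair; apply: subtruss_val_inj; rewrite /g /=.
    by rewrite rectangular_mid // hx.
  by rewrite tmulA rectangular_mid // hy.
- by move=> a b c; congr pair; apply: subtruss_val_inj; rewrite /= ?tmulHl ?tmulHr.
- move=> a b; congr pair; apply: subtruss_val_inj; rewrite /=.
    by rewrite tmulA !rectangular_mid.
  by rewrite !tmulA !rectangular_mid.
Qed.

Lemma empty_iso_square (T : trussType) :
  (T -> False) -> truss_isomorphic T (T * T)%type.
Proof.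
move=> noT; exists (fun a => (a, a)).
split; [|by move=> a; case: (noT a)..].
by exists fst => [a | [a b]]; case: (noT a).
Qed.

(** * The ring of a rectangular truss *)

(** An element absorbed into [e] from both sides is [e] itself, since
    [x = x * e * x]; this reduces the claim to two short heap computations. *)
Lemma rectangular_rmul0 (T : trussType) (rectT : rectangular T) (e a b : T) :
  truss_rmul e a b = e.
Proof.
set x := truss_rmul e a b.
have ee : e * e = e by exact: rectangular_idem.
have ex : e * x = e.
  rewrite /x /truss_rmul !tmulHr !tmulA !rectangular_mid // ee heapK.
  exact: heapKl.
have xe : x * e = e.
  rewrite /x /truss_rmul !tmulHl !rectangular_mid // ee heapK.
  exact: heapKl.
by rewrite -(rectT x e) xe ex.
Qed.

(** * The characterization *)

Theorem corollary3p10 (T : trussType) :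
  (rectangular T <->
   exists L R : trussType,
     [/\ left_zero_truss L, right_zero_truss R
       & truss_isomorphic T (L * R)%type]) /\
  (rectangular T -> forall e : T, zero_multiplication (truss_ring e)).
Proof.
split; last by move=> rectT e a b; exact: rectangular_rmul0.
split; last by move=> [L [R [zL zR]]]; exact: rectangular_of_iso_prod.
move=> rectT; case: (classic (inhabited T)) => [[e] | emptyT].
  exists (left_factor e), (right_factor e).
  split; [exact: left_factor_zero | exact: right_factor_zero |].
  exact: rectangular_iso.
have noT (a : T) : False by apply: emptyT; exists.
by exists T, T; split; [move=> a; case: (noT a).. | exact: empty_iso_square].
Qed.
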